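(* For every positive integer $k$, every (nonempty) Eulerian digraph of minimum out-degree at least $18k^4$ contains a spanning $C_4^{(2,2)}$-free subdigraph in which every vertex has out-degree exactly $k$. In particular, $C_4^{(2,2)}$ is Eulerian-avoidable.
   Context: All digraphs are finite and loopless, with no parallel arcs; digons (pairs of oppositely directed arcs between two vertices) are allowed. A digraph is Eulerian if every vertex has equal in-degree and out-degree (no connectivity is required). $C_4^{(2,2)}$ is the digraph on vertex set $\{a,b,c,d\}$ with arc set $\{a\to b,\ a\to d,\ b\to c,\ d\to c\}$. A digraph is $F$-free if it has no (not necessarily induced) subdigraph isomorphic to $F$. A subdigraph is spanning if it has the same vertex set as the host digraph. A digraph $F$ is Eulerian-avoidable if, for every positive integer $k$, there exists an integer $d$ such that every (nonempty) Eulerian digraph of minimum out-degree at least $d$ contains a (nonempty) $F$-free subdigraph (not required to be Eulerian) of minimum out-degree at least $k$. *)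

(* Defs.v *)
From mathcomp Require Import all_boot.

Set Implicit Arguments.
Unset Strict Implicit.
Unset Printing Implicit Defensive.

(* A [rel] on the vertices excludes parallel arcs and allows digons. *)
Record digraph := Digraph {
  vertex :> finType;
  arc : rel vertex;
  arc_irr : irreflexive arc }.

Definition outdeg (D : digraph) (v : D) : nat := #|[set u : D | arc v u]|.
Definition indeg (D : digraph) (v : D) : nat := #|[set u : D | arc u v]|.

Definition nonempty (D : digraph) : Prop := 0 < #|D|.

Definition eulerian (D : digraph) : Prop := forall v : D, outdeg v = indeg v.

Definition min_outdeg_geq (d : nat) (D : digraph) : Prop :=
  forall v : D, d <= outdeg v.

Definition isomorphic (D E : digraph) : Prop :=
  exists f : D -> E, bijective f /\ forall u v : D, arc (f u) (f v) = arc u v.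

Record subdigraph (D : digraph) := Subdigraph {
  sub_vset : {set D};
  sub_arc : rel D;
  sub_arcP : forall u v : D, sub_arc u v ->
    [/\ u \in sub_vset, v \in sub_vset & arc u v] }.

Section SubdigraphAsDigraph.

Variables (D : digraph) (H : subdigraph D).

Definition sub_rel : rel {v : D | v \in sub_vset H} :=
  fun u v => sub_arc H (val u) (val v).

Lemma sub_rel_irr : irreflexive sub_rel.
Proof.
move=> u; apply/negP=> /(sub_arcP (s := H)) [_ _].
by rewrite arc_irr.
Qed.

Definition digraph_of_sub : digraph := Digraph sub_rel_irr.

End SubdigraphAsDigraph.

Coercion digraph_of_sub : subdigraph >-> digraph.

Definition spanning (D : digraph) (H : subdigraph D) : Prop :=
  sub_vset H = [set: D].

Definition free (F D : digraph) : Prop :=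
  ~ exists H : subdigraph D, isomorphic F H.

Definition eulerian_avoidable (F : digraph) : Prop :=
  forall k : nat, 0 < k ->
  exists d : nat, forall D : digraph,
    nonempty D -> eulerian D -> min_outdeg_geq d D ->
    exists H : subdigraph D,
      [/\ nonempty H, free F H & min_outdeg_geq k H].

(* The vertices a, b, c, d are 0, 1, 2, 3. *)
Definition C4_22_arc : rel 'I_4 := fun u v =>
  (val u, val v) \in [:: (0, 1); (0, 3); (1, 2); (3, 2)].

Lemma C4_22_arc_irr : irreflexive C4_22_arc.
Proof. by case=> [[|[|[|[|]]]] ?]. Qed.

Definition C4_22 : digraph := Digraph C4_22_arc_irr.

(* Main.v *)
From mathcomp Require Import all_boot all_order all_algebra.
From mathcomp Require Import ring lra zify.
Require Import Defs.

(** Let every vertex [v] choose a uniformly random [k]-subset [f v] of its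
    out-neighbours, independently of the others, and keep the arcs [v -> u]
    with [u] in [f v].  All out-degrees are then [k], and a copy of [C4_22]
    forces a bad event: for some [a, b, d, c] with [b != d], both [b] and [d]
    are chosen by [a], and [c] is chosen by [b] and by [d].  Its probability is
    at most [k^4 / (n_a^2 n_b n_d)], where [n_v] is the out-degree of [v]
    ([prob_two_paths]).

    The degrees may be wildly different, so these probabilities are summed
    vertex by vertex.  Write [m] for the minimum out-degree, and sum over the
    events in which a given vertex [v] makes a choice.
    - If [v] is the source [a], there are [n_v^2] pairs [(b, d)], and [n_b]
      vertices [c] for each: the sum is at most the average of [k^4 / n_d].
    - If [v] is a middle vertex, call it [b] (the event is symmetric in [b] and
      [d]).  There are as many [a] as in-neighbours of [v], that is [n_v] of
      them because the digraph is Eulerian, then [n_a] vertices [d], and [n_d]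
      vertices [c]: the sum is at most the average of [k^4 / n_a].
    Both are at most [k^4 / m], hence at most [1/18].

    A choice without bad events then exists by a counting argument in the style
    of Rosenfeld, which here replaces the Lovasz Local Lemma
    ([avoid_bad_events]).  Let [p S] be the probability that no bad event takes
    place inside the vertex set [S].  By induction on [S], adding one vertex at
    most halves [p S]: the choices that get lost contain a bad event [i] at the
    new vertex, and are good on [S] minus the support of [i]; by independence
    they have probability at most [P(i) p (S minus supp i)], which by induction
    is at most [P(i) 2^(|supp i| - 1) p S].  So it suffices that
    [2^|supp i| P(i)] sums to at most [1] at every vertex, and supports of size
    at most [3] give [8 (1/18 + 1/18) < 1]. *)

Set Implicit Arguments.
Unset Strict Implicit.
Unset Printing Implicit Defensive.

Import Order.TTheory GRing.Theory Num.Theory.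

(** * Independent uniform choices *)

Section UniformChoice.

Local Open Scope ring_scope.

Variables (V T : finType) (Q : V -> {set T}).
Implicit Types (f g : {ffun V -> T}) (E F : pred {ffun V -> T}) (X S : {set V}).

Definition choices : {set {ffun V -> T}} := [set f in family Q].

Definition prob E : rat :=
  #|[set f in choices | E f]|%:R / #|choices|%:R.

Definition depends_on X E := forall f g, {in X, f =1 g} -> E f = E g.

Lemma prob_ge0 E : 0 <= prob E.
Proof. by rewrite divr_ge0 ?ler0n. Qed.

Lemma prob_le E F : {in choices, forall f, E f -> F f} -> prob E <= prob F.
Proof.
move=> EF; rewrite ler_wpM2r ?invr_ge0 ?ler0n // ler_nat subset_leq_card //.
by apply/subsetP=> f; rewrite !inE => /andP[Qf Ef]; rewrite Qf EF // inE.
Qed.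

Lemma prob_gt0_ex E : 0 < prob E -> exists2 f, f \in choices & E f.
Proof.
rewrite /prob; case: (set_0Vmem [set f in choices | E f]) => [->|[f]].
  by rewrite cards0 mul0r.
by rewrite inE => /andP[Qf Ef] _; exists f.
Qed.

Lemma probT E : (0 < #|choices|)%N -> {in choices, forall f, E f} -> prob E = 1.
Proof.
move=> Q0 ET; rewrite /prob.
have ->: [set f in choices | E f] = choices.
  by apply/setP=> f; rewrite inE; case: (boolP (f \in choices)) => //= /ET.
by rewrite divff // pnatr_eq0 -lt0n.
Qed.

Lemma prob_split E F :
  prob E <= prob F + prob (fun f => E f && ~~ F f).
Proof.
rewrite /prob -mulrDl -natrD ler_wpM2r ?invr_ge0 ?ler0n // ler_nat.
apply: leq_trans (leq_card_setU _ _); apply/subset_leq_card/subsetP => f.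
by rewrite !inE => /andP[-> ->]; case: (F f).
Qed.

Lemma prob_union (I : finType) (A : pred I) E (B : I -> pred {ffun V -> T}) :
  {in choices, forall f, E f -> exists2 i, A i & B i f} ->
  prob E <= \sum_(i | A i) prob (B i).
Proof.
move=> EB; rewrite /prob -mulr_suml -natr_sum ler_wpM2r ?invr_ge0 ?ler0n //.
rewrite ler_nat.
have card_sum (C : pred {ffun V -> T}) :
    #|[set f in choices | C f]| = (\sum_(f in choices) C f)%N.
  rewrite -sum1_card big_mkcond [RHS]big_mkcond; apply: eq_bigr => f _.
  by rewrite in_set; case: (f \in choices); case: (C f).
rewrite card_sum; under [leqRHS]eq_bigr do rewrite card_sum.
rewrite exchange_big /=; apply: leq_sum => f Qf.
case Ef: (E f) => //; have [i Ai Bif] := EB f Qf Ef.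
by rewrite (bigD1 i Ai) Bif.
Qed.

Definition mix X f g := [ffun v => if v \in X then f v else g v].

Lemma mix_choices X f g :
  f \in choices -> g \in choices -> mix X f g \in choices.
Proof.
rewrite !inE => /familyP Qf /familyP Qg; apply/familyP => v.
by rewrite ffunE; case: ifP.
Qed.

(** Exchanging the coordinates in [X] between two choices is an involution, and
    it sends a pair [(f, g)] with [E f && F f] to one with [E] on the first and
    [F] on the second component. *)
Lemma prob_indep X E F : depends_on X E -> depends_on (~: X) F ->
  prob (fun f => E f && F f) <= prob E * prob F.
Proof.
move=> dE dF; rewrite /prob mulf_div.
have [->|Q0] := posnP #|choices|; first by rewrite mulr0 invr0 !mulr0.
rewrite ler_pdivlMr ?mulr_gt0 ?ltr0n // mulrA divfK ?pnatr_eq0 -?lt0n //.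
rewrite -!natrM ler_nat -!cardsX.
pose swap (p : {ffun V -> T} * {ffun V -> T}) := (mix X p.1 p.2, mix X p.2 p.1).
have swapK : involutive swap.
  move=> [f g]; rewrite /swap /=.
  by congr (_, _); apply/ffunP => v; rewrite !ffunE; case: (v \in X).
rewrite -[leqLHS](card_imset _ (inv_inj swapK)).
apply/subset_leq_card/subsetP => q.
case/imsetP=> -[f g] + ->{q}.
have in_event H h :
    (h \in [set f in choices | H f]) = (h \in choices) && H h by rewrite in_set.
rewrite in_setX in_event => /andP[/= /andP[Qf /andP[Ef Ff]] Qg].
rewrite in_setX !in_event !mix_choices //=.
rewrite (dE _ f) ?(dF _ f) ?Ef ?Ff // => v; rewrite ffunE.
  by rewrite inE => /negPf->.
by move->.
Qed.

Lemma prob_coord v (P : pred T) :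
  prob (fun f => P (f v)) <= #|[set x in Q v | P x]|%:R / #|Q v|%:R.
Proof.
have card_fam (R : V -> {set T}) :
    #|[set f | f \in family R]| = (\prod_u #|R u|)%N.
  rewrite cardsE card_family foldrE big_image /=.
  by apply: eq_bigr.
pose R u := if u == v then [set x in Q v | P x] else Q u.
have ->: prob (fun f => P (f v))
    = #|[set f | f \in family R]|%:R / #|choices|%:R.
  congr (_%:R / _); apply: eq_card => f; rewrite !inE.
  apply/andP/familyP => [[/familyP Qf Pf] u|Rf].
    by rewrite /R; case: eqP => // ->; rewrite !inE Pf Qf.
  split; last by move: (Rf v); rewrite /R eqxx inE => /andP[].
  apply/familyP => u; move: (Rf u); rewrite /R; case: eqP => // ->.
  by rewrite inE => /andP[].
rewrite !card_fam (bigD1 v) // [X in _ / X%:R](bigD1 v) //= {1}/R eqxx.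
rewrite (eq_bigr (fun u => #|Q u|)) => [|u /negPf uv]; last by rewrite /R uv.
rewrite !natrM -mulf_div ler_piMr ?divr_ge0 ?ler0n //.
by case: (posnP (\prod_(u | u != v) #|Q u|)) => [->|p0];
   rewrite ?mul0r // divff // pnatr_eq0 -lt0n.
Qed.

End UniformChoice.

(** * Avoiding bad events with small weight at every coordinate *)

Section Avoidance.

Local Open Scope ring_scope.

Variables (V T I : finType) (Q : V -> {set T}).
Variables (supp : I -> {set V}) (bad : I -> pred {ffun V -> T}).
(* An event may be listed under several indices; [J v] needs to hold only one
   index for each event that involves [v], which keeps repetitions out of the
   sum in [J_light]. *)
Variable (J : V -> {set I}).

Hypothesis Q_neq0 : (0 < #|choices Q|)%N.
Hypothesis supp_neq0 : forall i, supp i != set0.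
Hypothesis bad_supp : forall i, depends_on (supp i) (bad i).
Hypothesis J_cover : forall i v f, f \in choices Q -> v \in supp i ->
  bad i f -> exists2 j, j \in J v & supp j = supp i /\ bad j f.
Hypothesis J_light : forall v,
  \sum_(j in J v) 2 ^+ #|supp j| * prob Q (bad j) <= 1.

Let good (S : {set V}) : pred {ffun V -> T} :=
  fun f => [forall i, (supp i \subset S) ==> ~~ bad i f].

Let good_dep S : depends_on S (good S).
Proof.
move=> f g fg; apply: eq_forallb => i.
case: (boolP (supp i \subset S)) => //= sS.
by rewrite (bad_supp (g := g)) // => v vi; rewrite fg // (subsetP sS).
Qed.

(** Iterates the halving step from [S] up to [S'], for [S'] small enough that
    the induction of [good_step] has reached all sets in between. *)
Let good_chain n :
  (forall (S : {set V}) v, (#|S| < n)%N -> v \notin S ->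
     prob Q (good S) <= 2 * prob Q (good (v |: S))) ->
  forall S S' : {set V}, S \subset S' -> (#|S'| <= n)%N ->
  prob Q (good S) <= 2 ^+ #|S' :\: S| * prob Q (good S').
Proof.
move=> step S S'; move Dm: #|S' :\: S| => m.
elim: m S' Dm => [|m IH] S' Dm sSS' leS'.
  have /eqP := Dm; rewrite cards_eq0 setD_eq0 => sS'S.
  by rewrite mul1r (_ : S' = S) //; apply/eqP; rewrite eqEsubset sS'S.
have /card_gt0P[x] : (0 < #|S' :\: S|)%N by rewrite Dm.
rewrite inE => /andP[xS xS'].
have cS' : #|S'| = #|S' :\ x|.+1 by rewrite (cardsD1 x S') xS'.
have := IH (S' :\ x); rewrite setDDl setUC -setDDl.
have -> : #|(S' :\: S) :\ x| = m.
  by move: Dm; rewrite (cardsD1 x) !inE xS xS' => -[].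
rewrite subsetD1 sSS' xS -(ltnS #|_|) -cS' => /(_ erefl isT (leqW leS')) le1.
apply: le_trans le1 _; rewrite exprSr -mulrA ler_wpM2l ?exprn_ge0 //.
have := step (S' :\ x) x; rewrite setD1K // !inE eqxx -cS'.
exact.
Qed.

(** The halving step; [lost] is the union bound over the bad events that appear
    with the new vertex, and [small] bounds it by independence. *)
Let good_step (S : {set V}) v : v \notin S ->
  prob Q (good S) <= 2 * prob Q (good (v |: S)).
Proof.
move Dn: #|S| => n; elim/ltn_ind: n => n IH in S v Dn * => vS.
have step (S0 : {set V}) v0 : (#|S0| < n)%N -> v0 \notin S0 ->
    prob Q (good S0) <= 2 * prob Q (good (v0 |: S0)).
  by move=> lt0; apply: (IH _ lt0).
have chain := good_chain step.
pose A j := [&& j \in J v, v \in supp j & supp j \subset v |: S].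
have lost : prob Q (fun f => good S f && ~~ good (v |: S) f)
    <= \sum_(j | A j) prob Q (fun f => bad j f && good (S :\: supp j) f).
  apply: prob_union => f Qf /andP[gS /forallPn[i]].
  rewrite negb_imply negbK => /andP[sub_i bad_i].
  have vi : v \in supp i.
    apply: contraLR bad_i => vi; have /forallP/(_ i)/implyP-> // := gS.
    apply/subsetP => u ui; have := subsetP sub_i u ui.
    by rewrite in_setU1 => /orP[/eqP uv|//]; rewrite -uv ui in vi.
  have [j jJ [sj bad_j]] := J_cover Qf vi bad_i.
  exists j; first by rewrite /A jJ sj vi.
  rewrite bad_j; apply/forallP => i'; apply/implyP => si'.
  have /forallP/(_ i')/implyP-> // := gS.
  by apply: subset_trans si' _; apply: subsetDl.
have small : \sum_(j | A j) prob Q (fun f => bad j f && good (S :\: supp j) f)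
    <= 2^-1 * prob Q (good S).
  apply: (@le_trans _ _ (\sum_(j | A j)
      2^-1 * prob Q (good S) * (2 ^+ #|supp j| * prob Q (bad j)))).
    apply: ler_sum => j /and3P[_ vj sj].
    have dS : depends_on (~: supp j) (good (S :\: supp j)).
      move=> f g fg; apply: good_dep => u; rewrite inE => /andP[uj _].
      by apply: fg; rewrite inE.
    apply: le_trans (prob_indep Q (bad_supp (i := j)) dS) _.
    have := chain (S :\: supp j) S (subsetDl _ _); rewrite Dn leqnn => /(_ isT).
    (* As [v] is outside [S], the chain has one vertex less than [supp j]. *)
    have -> : S :\: (S :\: supp j) = supp j :\ v.
      apply/setP => u; rewrite !inE negb_and negbK.
      have := subsetP sj u; rewrite in_setU1.
      case: (u =P v) => [->|_] /=; first by rewrite (negPf vS) andbF.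
      by case: (u \in supp j) => //= [-> //|_]; rewrite andNb.
    rewrite (cardsD1 v (supp j)) vj exprS => le_S.
    have := ler_wpM2l (prob_ge0 Q (bad j)) le_S; lra.
  rewrite -mulr_sumr ler_piMr ?(mulr_ge0 _ (prob_ge0 _ _)) //.
  apply: le_trans (J_light v).
  rewrite [leLHS]big_mkcond [leRHS]big_mkcond /=; apply: ler_sum => j _.
  rewrite /A; case: (j \in J v) => //=; case: ifP => // _.
  by rewrite mulr_ge0 ?exprn_ge0 ?prob_ge0.
have := prob_split Q (good S) (good (v |: S)); lra.
Qed.

Theorem avoid_bad_events : exists2 f, f \in choices Q & forall i, ~~ bad i f.
Proof.
have p0 : prob Q (good set0) = 1.
  apply: probT => // f _; apply/forallP => i.
  by rewrite subset0 (negPf (supp_neq0 i)).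
have /prob_gt0_ex[f Qf gf] : 0 < prob Q (good setT).
  have := @good_chain #|V| (fun S v _ => @good_step S v) set0 setT (sub0set _).
  rewrite p0 cardsT => /(_ (leqnn _)) le1.
  have := lt_le_trans (ltr01 : 0 < 1 :> rat) le1.
  by rewrite pmulr_rgt0 // exprn_gt0.
by exists f => // i; have /forallP/(_ i) := gf; rewrite subsetT.
Qed.

End Avoidance.

(** * Subsets of given size through one or two given points *)

Section Draws.

Variable T : finType.
Implicit Types (A N X : {set T}) (k : nat).

Definition draws k N : {set {set T}} :=
  [set A : {set T} | A \subset N & #|A| == k].

(** Removing [X] is injective on the sets that contain it; the boolean factors
    account for the cases where there is no such set. *)
Lemma card_draws_containing k N X :
  #|[set A in draws k N | X \subset A]| <=
    (X \subset N) * (#|X| <= k) * 'C(#|N| - #|X|, k - #|X|).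
Proof.
have [/andP[sXN le_Xk]|out] := boolP ((X \subset N) && (#|X| <= k)); last first.
  rewrite (_ : [set A in _ | _] = set0) ?cards0 //.
  apply/setP => A; rewrite !inE; apply: contraNF out.
  case/andP=> /andP[sAN /eqP<-] sXA.
  by rewrite (subset_trans sXA sAN) subset_leq_card.
rewrite sXN le_Xk !mul1n -cardsDS // -cards_draws.
rewrite -[leqLHS](@card_in_imset _ _ (fun A => A :\: X)) => [|A B].
  apply/subset_leq_card/subsetP => _ /imsetP[A + ->].
  rewrite !inE => /andP[/andP[sAN /eqP Ak] sXA].
  by rewrite setSD //= cardsDS // Ak.
rewrite !inE => /andP[_ sXA] /andP[_ sXB] eqD.
by rewrite -(setID A X) -(setID B X) eqD (setIidPr sXA) (setIidPr sXB).
Qed.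

Lemma draws_containing1 k N x :
  #|[set A in draws k N | x \in A]| * #|N| <= k * #|draws k N|.
Proof.
have := card_draws_containing k N [set x]; rewrite sub1set cards1 cards_draws.
under eq_finset do rewrite sub1set.
case: (x \in N) => /=; last by rewrite !mul0n leqn0 => /eqP->.
case: k => [|k]; first by rewrite muln0 mul0n leqn0 => /eqP->.
by rewrite !mul1n !subn1 -mul_bin_diag mulnC leq_mul2l => ->; rewrite orbT.
Qed.

(** The quotient of the two binomials is exactly
    [(k.+2 * k.+1) / (n.+2 * n.+1)], and [k.+1 / n.+1 <= k.+2 / n.+2]. *)
Lemma sqr_bin_le n k : k <= n ->
  'C(n, k) * n.+2 ^ 2 <= k.+2 ^ 2 * 'C(n.+2, k.+2).
Proof.
move=> le_kn; rewrite -(leq_pmul2l (ltn0Sn n)).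
have e1 : n.+2 * 'C(n.+1, k.+1) = k.+2 * 'C(n.+2, k.+2) by apply: mul_bin_diag.
have e2 : n.+1 * 'C(n, k) = k.+1 * 'C(n.+1, k.+1) by apply: mul_bin_diag.
have -> : n.+1 * ('C(n, k) * n.+2 ^ 2)
    = (n.+2 * k.+1) * (k.+2 * 'C(n.+2, k.+2)) by rewrite -e1 mulnA e2; ring.
have -> : n.+1 * (k.+2 ^ 2 * 'C(n.+2, k.+2))
    = (n.+1 * k.+2) * (k.+2 * 'C(n.+2, k.+2)) by ring.
by rewrite leq_mul2r; apply/orP; right; clear - le_kn; nia.
Qed.

Lemma draws_containing2 k N x y : k <= #|N| -> x != y ->
  #|[set A in draws k N | (x \in A) && (y \in A)]| * #|N| ^ 2
    <= k ^ 2 * #|draws k N|.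
Proof.
move=> le_kN xy.
have := card_draws_containing k N [set x; y]; rewrite cards2 xy cards_draws.
under eq_finset do rewrite subUset !sub1set.
case: ([set x; y] \subset N) => /=; last by rewrite !mul0n leqn0 => /eqP->.
case: k le_kN => [|[|k]]; try by rewrite muln0 mul0n leqn0 => _ /eqP->.
case: #|N| => [|[|n]] // le_kn; rewrite !mul1n !subSS !subn0 => le_card.
by apply: leq_trans (sqr_bin_le _) => //; rewrite leq_mul2r le_card orbT.
Qed.

End Draws.

(** * Choosing out-neighbours without two paths of length two *)

(** Meant for a set of quadruples with one entry fixed: the free entries are
    summed one after the other, each over a neighbourhood of an earlier one. *)
Lemma sum_triples (R : nmodType) (T I : finType) (h : T * T * T -> I) h'
    (P1 : pred T) (P2 : T -> pred T) (P3 : T -> T -> pred T)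
    (S : {set I}) (G : I -> R) :
  cancel h h' -> {in S, cancel h' h} ->
  (forall x y z, (h (x, y, z) \in S) = [&& P1 x, P2 x y & P3 x y z]) ->
  (\sum_(i in S) G i
   = \sum_(x | P1 x) \sum_(y | P2 x y) \sum_(z | P3 x y z) G (h (x, y, z)))%R.
Proof.
move=> hK h'K hS; rewrite (reindex_onto h h' h'K) !pair_big_dep /=.
apply: eq_big => [[[x y] z]|[[x y] z] _] //=.
by rewrite hK eqxx andbT hS andbA.
Qed.

Section FreeChoice.

Local Open Scope ring_scope.

Variables (D : digraph) (k : nat).
Hypothesis k_gt0 : (0 < k)%N.
Hypothesis D_eulerian : eulerian D.
Hypothesis D_dense : min_outdeg_geq (18 * k ^ 4)%N D.

Let N (v : D) := [set u : D | arc v u].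
Let Q v := draws k (N v).

(** A quadruple lists source, the two middle vertices, and the common end: the
    end comes last because it makes no choice in the event. *)
Definition two_paths (i : D * D * D * D) (f : {ffun D -> {set D}}) : bool :=
  let: (a, b, d, c) := i in
  [&& b != d, b \in f a, d \in f a, c \in f b & c \in f d].

Definition tails (i : D * D * D * D) : {set D} :=
  let: (a, b, d, c) := i in a |: [set b; d].

(** The events with [v] as source or as first middle vertex.  The case of the
    second middle vertex is reached by exchanging the middle vertices. *)
Definition charged (v : D) : {set D * D * D * D} :=
  [set i | let: (a, b, d, c) := i in
    [&& a == v, arc a b, arc a d & arc b c]]
  :|: [set i | let: (a, b, d, c) := i in
    [&& b == v, arc a b, arc a d & arc d c]].

Let le_k_outdeg (v : D) : (k <= outdeg v)%N.
Proof.
apply: leq_trans (D_dense v); rewrite -[leqLHS]mul1n leq_mul //.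
by rewrite -[leqLHS]expn1 leq_pexp2l.
Qed.

Let mem_choices (f : {ffun D -> {set D}}) (v u : D) :
  f \in choices Q -> u \in f v -> arc v u.
Proof.
rewrite inE => /familyP/(_ v); rewrite !inE => /andP[/subsetP sN _] /sN.
by rewrite inE.
Qed.

Let draws_gt0 v : (0 < #|Q v|)%N.
Proof. by rewrite cards_draws bin_gt0 le_k_outdeg. Qed.

Let choices_gt0 : (0 < #|choices Q|)%N.
Proof.
have /fin_all_exists[f Qf] : forall v, exists A, A \in Q v.
  by move=> v; have /card_gt0P[A] := draws_gt0 v; exists A.
apply/card_gt0P; exists (finfun f); rewrite inE.
by apply/familyP=> v; rewrite ffunE.
Qed.

Let prob_choose1 (v u : D) :
  prob Q (fun f => u \in f v) <= k%:R / (outdeg v)%:R.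
Proof.
apply: le_trans (prob_coord Q v (fun A => u \in A)) _.
have n0 : (0 < outdeg v)%N by apply: leq_trans (le_k_outdeg v).
rewrite ler_pdivrMr ?ltr0n // mulrAC ler_pdivlMr ?ltr0n // -!natrM ler_nat.
exact: draws_containing1.
Qed.

Let prob_choose2 (v u w : D) : u != w ->
  prob Q (fun f => (u \in f v) && (w \in f v))
    <= k%:R ^+ 2 / (outdeg v)%:R ^+ 2.
Proof.
move=> uw.
apply: le_trans (prob_coord Q v (fun A => (u \in A) && (w \in A))) _.
have n0 : (0 < outdeg v)%N by apply: leq_trans (le_k_outdeg v).
rewrite ler_pdivrMr ?ltr0n // mulrAC ler_pdivlMr ?exprn_gt0 ?ltr0n //.
rewrite -!natrX -!natrM ler_nat.
exact: (draws_containing2 (le_k_outdeg v) uw).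
Qed.

Let depends1 (v : D) (P : pred {set D}) (X : {set D}) :
  v \in X -> depends_on X (fun f => P (f v)).
Proof. by move=> vX f g fg; rewrite fg. Qed.

(** The three choices are made at distinct vertices: [a] differs from [b] and
    [d] because there are no loops. *)
Let prob_two_paths (a b d c : D) : prob Q (two_paths (a, b, d, c))
  <= k%:R ^+ 4 / ((outdeg a)%:R ^+ 2 * (outdeg b)%:R * (outdeg d)%:R).
Proof.
have [/and3P[bd ab ad]|no] := boolP [&& b != d, arc a b & arc a d]; last first.
  apply: (@le_trans _ _ (prob Q pred0)).
    apply: prob_le => f Qf /and5P[bd fb fd _ _].
    by rewrite bd !(mem_choices Qf) in no.
  rewrite /prob (_ : [set _ in _ | _] = set0); last first.
    by apply/setP => f; rewrite in_set andbF in_set0.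
  by rewrite cards0 mul0r divr_ge0 ?mulr_ge0 ?exprn_ge0 ?ler0n.
have ba : b != a by apply: contraTneq ab => ->; rewrite arc_irr.
have da : d != a by apply: contraTneq ad => ->; rewrite arc_irr.
pose E1 (f : {ffun D -> {set D}}) := (b \in f a) && (d \in f a).
pose E2 (f : {ffun D -> {set D}}) := c \in f b.
pose E3 (f : {ffun D -> {set D}}) := c \in f d.
apply: (@le_trans _ _ (prob Q (fun f => E1 f && (E2 f && E3 f)))).
  by apply: prob_le => f _ /and5P[_ fb fd fc fc']; rewrite /E1 /E2 /E3 fb fd fc.
have -> : k%:R ^+ 4 / ((outdeg a)%:R ^+ 2 * (outdeg b)%:R * (outdeg d)%:R)
    = (k%:R ^+ 2 / (outdeg a)%:R ^+ 2)
      * ((k%:R / (outdeg b)%:R) * (k%:R / (outdeg d)%:R)) :> rat.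
  by rewrite !mulf_div -expr2 -exprD mulrA.
apply: le_trans (prob_indep Q (X := [set a]) _ _) _.
- by apply: (@depends1 _ (fun A => (b \in A) && (d \in A))); rewrite inE.
- by move=> f g fg; rewrite /E2 /E3 !fg ?inE.
apply: ler_pM; rewrite ?prob_ge0 ?prob_choose2 //.
apply: le_trans (prob_indep Q (X := [set b]) _ _) _.
- by apply: (@depends1 _ (fun A => c \in A)); rewrite inE.
- by apply: (@depends1 _ (fun A => c \in A)); rewrite !inE eq_sym.
by apply: ler_pM; rewrite ?prob_ge0 ?prob_choose1.
Qed.

Let sum_share (P : pred D) n (y : rat) : n = #|[set u | P u]| -> 0 <= y ->
  \sum_(u | P u) y / n%:R <= y.
Proof.
move=> nE y0; rewrite sumr_const -[X in X <= _]mulr_natr -cardsE -nE.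
have [->|n0] := posnP n; first by rewrite mulr0.
by rewrite divfK // pnatr_eq0 -lt0n.
Qed.

(** With [K = k^4] and one degree [n], the factor [8 K / n] of the weight is at
    most [1/2]; the other three degrees stay, to cancel the numbers of terms. *)
Let half_share (K n x y z : rat) : 0 <= K -> 0 < n -> 18 * K <= n ->
  0 <= x -> 0 <= y -> 0 <= z ->
  2 ^+ 3 * (K / n / x / y / z) <= 2^-1 / x / y / z.
Proof.
move=> K0 n0 Kn x0 y0 z0; rewrite !mulrA !ler_wpM2r ?invr_ge0 //.
by rewrite ler_pdivrMr //; lra.
Qed.

Let weight_two_paths (a b d c : D) (B : rat) :
  2 ^+ 3 * (k%:R ^+ 4
    / ((outdeg a)%:R ^+ 2 * (outdeg b)%:R * (outdeg d)%:R)) <= B ->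
  2 ^+ #|tails (a, b, d, c)| * prob Q (two_paths (a, b, d, c)) <= B.
Proof.
apply: le_trans; rewrite ler_pM ?prob_ge0 ?exprn_ge0 ?prob_two_paths //.
rewrite ler_eXn2l // cardsU1 cards2.
by case: (a \notin _); case: (b != d).
Qed.

Let charged_light (v : D) :
  \sum_(i in charged v) 2 ^+ #|tails i| * prob Q (two_paths i) <= 1.
Proof.
have n0 (u : D) : 0 < (outdeg u)%:R :> rat.
  by rewrite ltr0n; apply: leq_trans (le_k_outdeg u).
have nn (u : D) : (outdeg u)%:R != 0 :> rat by rewrite gt_eqF.
have n_ge (u : D) : 18 * k%:R ^+ 4 <= (outdeg u)%:R :> rat.
  by rewrite -natrX -natrM ler_nat.
have k0 : 0 <= k%:R ^+ 4 :> rat by rewrite exprn_ge0 ?ler0n.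
set S1 := [set i | let: (a, b, d, c) := i in
  [&& a == v, arc a b, arc a d & arc b c]].
set S2 := [set i | let: (a, b, d, c) := i in
  [&& b == v, arc a b, arc a d & arc d c]].
pose w i := 2 ^+ #|tails i| * prob Q (two_paths i).
have w0 i : 0 <= w i by rewrite mulr_ge0 ?exprn_ge0 ?prob_ge0.
have half1 : \sum_(i in S1) w i <= 2^-1.
  rewrite (sum_triples (h := fun t => (v, t.1.1, t.1.2, t.2))
    (h' := fun i => (i.1.1.2, i.1.2, i.2))
    (P1 := fun b => arc v b) (P2 := fun _ d => arc v d)
    (P3 := fun b _ c => arc b c)) //=; last first.
  - by move=> x y z; rewrite inE eqxx.
  - by move=> [[[a b] d] c]; rewrite inE => /and4P[/eqP->].
  - by move=> [[x y] z].
  apply: (@le_trans _ _ (\sum_(b | arc v b) 2^-1 / (outdeg v)%:R)); last first.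
    by apply: sum_share.
  apply: ler_sum => b _.
  apply: (@le_trans _ _ (\sum_(d | arc v d)
      2^-1 / (outdeg v)%:R / (outdeg v)%:R)); last first.
    by apply: sum_share; rewrite // divr_ge0.
  apply: ler_sum => d _.
  apply: (@le_trans _ _ (\sum_(c | arc b c)
      2^-1 / (outdeg v)%:R / (outdeg v)%:R / (outdeg b)%:R)); last first.
    by apply: sum_share; rewrite // !divr_ge0.
  apply: ler_sum => c _; apply: weight_two_paths.
  rewrite (_ : _ / (_ * _) = k%:R ^+ 4 / (outdeg d)%:R / (outdeg v)%:R
    / (outdeg v)%:R / (outdeg b)%:R) ?half_share //.
  by field; rewrite !nn.
have half2 : \sum_(i in S2) w i <= 2^-1.
  rewrite (sum_triples (h := fun t => (t.1.1, v, t.1.2, t.2))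
    (h' := fun i => (i.1.1.1, i.1.2, i.2))
    (P1 := fun a => arc a v) (P2 := fun a d => arc a d)
    (P3 := fun _ d c => arc d c)) //=; last first.
  - by move=> x y z; rewrite inE eqxx.
  - by move=> [[[a b] d] c]; rewrite inE => /and4P[/eqP->].
  - by move=> [[x y] z].
  apply: (@le_trans _ _ (\sum_(a | arc a v) 2^-1 / (outdeg v)%:R)); last first.
    (* The in-neighbours of [v] are as many as its out-neighbours. *)
    by apply: sum_share; rewrite // D_eulerian.
  apply: ler_sum => a _.
  apply: (@le_trans _ _ (\sum_(d | arc a d)
      2^-1 / (outdeg v)%:R / (outdeg a)%:R)); last first.
    by apply: sum_share; rewrite // divr_ge0.
  apply: ler_sum => d _.
  apply: (@le_trans _ _ (\sum_(c | arc d c)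
      2^-1 / (outdeg v)%:R / (outdeg a)%:R / (outdeg d)%:R)); last first.
    by apply: sum_share; rewrite // !divr_ge0.
  apply: ler_sum => c _; apply: weight_two_paths.
  rewrite (_ : _ / (_ * _) = k%:R ^+ 4 / (outdeg a)%:R / (outdeg v)%:R
    / (outdeg a)%:R / (outdeg d)%:R) ?half_share //.
  by field; rewrite !nn.
apply: (@le_trans _ _ (\sum_(i in S1) w i + \sum_(i in S2) w i)); last by lra.
rewrite big_mkcond [X in _ <= X + _]big_mkcond [X in _ <= _ + X]big_mkcond.
rewrite -big_split; apply: ler_sum => i _ /=; rewrite in_setU -/S1 -/S2 -/(w i).
by case: (i \in S1); case: (i \in S2);
   rewrite /= ?addr0 ?add0r ?ler_wpDl ?addr_ge0.
Qed.

Lemma free_choice_ex :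
  exists2 f, f \in choices Q & forall i, ~~ two_paths i f.
Proof.
apply: (avoid_bad_events choices_gt0 (supp := tails) (J := charged)) => //.
- by case=> [[[a b] d] c]; apply/set0Pn; exists a; rewrite !inE eqxx.
- move=> [[[a b] d] c] f g fg /=.
  by rewrite !fg ?inE ?eqxx ?orbT.
- move=> [[[a b] d] c] v f Qf; rewrite !inE => v_i bad_i.
  have /and5P[bd fb fd fc fc'] := bad_i.
  case/or3P: v_i => /eqP->.
  + by exists (a, b, d, c); rewrite // !inE /= eqxx !(mem_choices Qf).
  + by exists (a, b, d, c); rewrite // !inE /= eqxx !(mem_choices Qf) ?orbT.
  exists (a, d, b, c); first by rewrite !inE /= eqxx !(mem_choices Qf) ?orbT.
  by rewrite /tails [[set b; d]]setUC /= eq_sym bd fb fd fc fc'.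
Qed.

End FreeChoice.

(** * The subdigraph of a choice *)

Definition select (D : digraph) (f : {ffun D -> {set D}}) : rel D :=
  fun u v => arc u v && (v \in f u).

Lemma select_arcP (D : digraph) (f : {ffun D -> {set D}}) (u v : D) :
  select f u v -> [/\ u \in [set: D], v \in [set: D] & arc u v].
Proof. by rewrite !inE => /andP[]. Qed.

Lemma free_factor (k : nat) (D : digraph) :
  0 < k -> eulerian D -> min_outdeg_geq (18 * k ^ 4) D ->
  exists H : subdigraph D,
    [/\ spanning H, free C4_22 H & forall v : H, outdeg v = k].
Proof.
move=> k0 eD dD; have [f Qf nf] := free_choice_ex k0 eD dD.
exists (Subdigraph (@select_arcP D f)); split=> //.
  case=> H' [phi [/bij_inj phi_inj phi_arc]].
  have sel u v : C4_22_arc u v ->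
      val (val (phi v)) \in f (val (val (phi u))).
    move=> uv; have := phi_arc u v; rewrite [RHS]uv.
    by case/(sub_arcP (s := H')) => _ _ /andP[].
  pose o j : C4_22 := inord j.
  have := nf (val (val (phi (o 0))), val (val (phi (o 1))),
              val (val (phi (o 3))), val (val (phi (o 2)))).
  have sel' i j :
      (i, j) \in [:: (0, 1); (0, 3); (1, 2); (3, 2)] -> i < 4 -> j < 4 ->
      val (val (phi (o j))) \in f (val (val (phi (o i)))).
    by move=> ij i4 j4; apply: sel; rewrite /C4_22_arc /o /= !inordK.
  rewrite /two_paths !sel' // !andbT negbK => /eqP.
  move/val_inj/val_inj/phi_inj/(congr1 (@nat_of_ord 4)).
  by rewrite /o /= !inordK.
move=> v; have := Qf; rewrite inE => /familyP/(_ (val v)).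
rewrite inE => /andP[/subsetP sN /eqP <-].
rewrite /outdeg -(card_imset _ val_inj); apply: eq_card => u.
apply/imsetP/idP => [[u'] | uf].
  by rewrite inE => /andP[_ ?] ->.
have uT : u \in [set: D] by rewrite inE.
exists (Sub u uT) => //; rewrite inE /= /sub_rel /= /select uf andbT.
by have := sN _ uf; rewrite inE.
Qed.

Theorem theorem1p4 :
  (forall (k : nat) (D : digraph),
      0 < k -> nonempty D -> eulerian D -> min_outdeg_geq (18 * k ^ 4) D ->
      exists H : subdigraph D,
        [/\ spanning H, free C4_22 H & forall v : H, outdeg v = k])
  /\ eulerian_avoidable C4_22.
Proof.
split=> [k D k0 _|k k0]; first exact: free_factor.
exists (18 * k ^ 4) => D D0 eD dD.
have [H [spH fH kH]] := free_factor k0 eD dD.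
exists H; split=> // [|v]; last by rewrite kH.
have /card_gt0P[x _] := D0.
have xH : x \in sub_vset H by rewrite spH inE.
by apply/card_gt0P; exists (Sub x xH).
Qed.
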